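(* Let $(X,d)$ be a metric space, let $\Sigma$ be a non-empty family of non-empty subsets of $X$, and let $f\colon X\to\mathbb{R}$. Then the games $G_1(\Sigma,f)$ and $G_{<\omega}(\Sigma,f)$ are equivalent, i.e. Player I has a winning strategy in $G_1(\Sigma,f)$ if and only if Player I has a winning strategy in $G_{<\omega}(\Sigma,f)$, and Player II has a winning strategy in $G_1(\Sigma,f)$ if and only if Player II has a winning strategy in $G_{<\omega}(\Sigma,f)$.
   Context: The game $G_{<\omega}(\Sigma,f)$ is an infinite perfect-information game between Players I and II. At the initial step Player I plays a set $P\in\Sigma$, and then Player II plays a set $P_0$. At the $n$th step ($n\ge 1$) Player I plays a non-empty finite sequence of points $\langle x_i\colon k_{n-1}<i\le k_n\rangle$, where $k_0=0$ and $\langle k_n\rangle$ is a strictly increasing sequence of naturals (so Player I chooses $k_n>k_{n-1}$), and then Player II plays a set $P_n$. The rules are that for each integer $n\ge 0$: $P_n\in\Sigma$ and $P_n\subseteq P$ (the sets $P_n$ are not required to be decreasing), and $x_i\in P_n$ for $i=k_n+1,\dots,k_{n+1}$. Player II wins if the sequence $\langle x_n\rangle$ converges in $X$ and $\lim_{n\to\infty}f(x_n)=f(\lim_{n\to\infty}x_n)$; otherwise Player I wins. The game $G_1(\Sigma,f)$ is the same except that $k_n=n$ for every $n$, i.e. Player I plays exactly one point $x_n\in P_{n-1}$ at the $n$th step. *)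

(* Defs.v *)
From HB Require Import structures.
From mathcomp Require Export all_boot all_order all_algebra.
From mathcomp Require Export all_classical all_reals all_analysis.
Export numFieldNormedType.Exports.

Set Implicit Arguments.
Unset Strict Implicit.
Unset Printing Implicit Defensive.

Local Open Scope classical_set_scope.
Local Open Scope ring_scope.

(* All the moves of an infinite run: [initI] is the first set P played by I,
   [setII n] is P_n, [cut n] is k_n and [pt i] is x_i. Points are numbered from
   1, so [pt 0] is never played and carries no information. Legality is not
   built in: it is expressed by [legal_initI], [legal_stepI] and [legal_II]. *)
Record run (X : Type) := Run {
  initI : set X;
  setII : nat -> set X;
  cut : nat -> nat;
  pt : nat -> X;
  cut0 : cut 0 = 0%N }.

(* The finite sequence < x_i : k_n < i <= k_(n+1) > played by I at step n + 1. *)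
Definition moveI (X : Type) (r : run X) (n : nat) : seq X :=
  [seq pt r i | i <- index_iota (cut r n).+1 (cut r n.+1).+1].

(* Each player moves as a function of all the previous moves of the opponent,
   listed in chronological order; their own previous moves are determined by
   those. I answers P_0, ..., P_n; II answers P and the sequences of points
   played at steps 1, ..., n. *)
Record strategyI (X : Type) := StrategyI {
  strI_init : set X;
  strI_step : seq (set X) -> seq X }.

Definition strategyII (X : Type) := set X -> seq (seq X) -> set X.

Definition followsI (X : Type) (s : strategyI X) (r : run X) : Prop :=
  initI r = strI_init s /\
  forall n, moveI r n = strI_step s (mkseq (setII r) n.+1).

Definition followsII (X : Type) (t : strategyII X) (r : run X) : Prop :=
  forall n, setII r n = t (initI r) (mkseq (moveI r) n).

(* The two games differ only in the numbers of points that I is allowed to play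
   at one step, so a game is described by the set L of these numbers. *)
Definition G_one : set nat := [set l | l = 1%N].
Definition G_fin : set nat := [set l | (0 < l)%N].

Section Game.
Context (R : realType) (X : metricType R).
Variables (L : set nat) (Sigma : set (set X)) (f : X -> R).

Definition legal_initI (r : run X) : Prop := Sigma (initI r).

Definition legal_stepI (r : run X) (n : nat) : Prop :=
  L (cut r n.+1 - cut r n)%N /\
  forall i, (cut r n < i <= cut r n.+1)%N -> setII r n (pt r i).

Definition legal_II (r : run X) (n : nat) : Prop :=
  Sigma (setII r n) /\ setII r n `<=` initI r.

Definition payoffII (r : run X) : Prop :=
  exists l : X, pt r i @[i --> \oo] --> l /\ f (pt r i) @[i --> \oo] --> f l.

(* A winning strategy must give a legal move at every position reached by legal
   moves of the opponent, in addition to winning the complete legal runs: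
   otherwise II could win vacuously by playing an illegal empty set, to which
   I has no legal answer. *)
Definition winning_strategyI (s : strategyI X) : Prop :=
  forall r : run X, followsI s r ->
    [/\ legal_initI r,
        forall n, (forall m, (m <= n)%N -> legal_II r m) -> legal_stepI r n
      & (forall n, legal_II r n) -> ~ payoffII r].

Definition winning_strategyII (t : strategyII X) : Prop :=
  forall r : run X, followsII t r -> legal_initI r ->
    (forall n, (forall m, (m < n)%N -> legal_stepI r m) -> legal_II r n) /\
    ((forall n, legal_stepI r n) -> payoffII r).

Definition I_wins : Prop := exists s : strategyI X, winning_strategyI s.

Definition II_wins : Prop := exists t : strategyII X, winning_strategyII t.

End Game.

(* Main.v *)
Require Import Defs.
From mathcomp Require Import all_boot all_order all_algebra.
From mathcomp Require Import all_classical all_reals all_analysis.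
From mathcomp Require Import zify lra.

Set Implicit Arguments.
Unset Strict Implicit.
Unset Printing Implicit Defensive.
Import Order.TTheory GRing.Theory Num.Theory.

Local Open Scope classical_set_scope.

(** Everything depends on one condition on Sigma and f: every P in Sigma
    contains members of Sigma that shrink, in the graph of f, to a single point
    (l, f l); this is [shrinkable].

    If it holds, Player II wins both games by playing at step n a member of
    Sigma inside P that lies in the graph ball of radius 1/(n+1) around l,
    whatever Player I does ([shrinkable_II_wins]). It does not matter how many
    points are then taken from that set.

    If it fails at P, Player I wins with one point per step: every point x has a
    radius such that no member of Sigma inside P fits in the graph ball of that
    radius around x, so the next point can be chosen outside the largest such
    ball (with radius of the form 1/(k+1)) around the current one. If the points
    converged to some l in the graph, then the radii would stay bounded below
    near l, whereas the steps would tend to 0 ([not_shrinkable_I_wins]).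

    Since at most one player has a winning strategy ([not_both_win]), the
    condition decides both games in the same way. The two remaining ingredients,
    that Player I only gains and Player II only loses when more numbers of
    points are allowed, hold because a strategy keeps its meaning
    ([I_wins_mono], [II_wins_anti]). *)

(** * The run determined by the moves *)

Section Runs.
Variable X : Type.

Lemma moveI_flatten (r : run X) (x0 : X) (u : nat -> seq X) :
  (forall n, Defs.cut r n = size (flatten (mkseq u n))) ->
  (forall n i, (i < Defs.cut r n)%N ->
     pt r i.+1 = nth x0 (flatten (mkseq u n)) i) ->
  forall n, moveI r n = u n.
Proof.
move=> cutE ptE n.
have cutS : Defs.cut r n.+1 = (Defs.cut r n + size (u n))%N.
  by rewrite !cutE mkseqS flatten_rcons size_cat.
apply: (@eq_from_nth _ x0) => [|j].
  by rewrite size_map size_iota subSS cutS addKn.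
rewrite size_map size_iota subSS cutS addKn => ltj.
rewrite (nth_map 0%N) ?size_iota ?subSS ?cutS ?addKn //.
rewrite nth_iota ?subSS ?addKn // addSn (ptE n.+1) ?cutS ?ltn_add2l //.
by rewrite mkseqS flatten_rcons nth_cat -cutE ltnNge leq_addr addKn.
Qed.

(** Moves of any lengths, possibly empty, come from a run. The x_i are read in
    the concatenation of sufficiently many moves; if all moves together have
    fewer than i points, then x_i belongs to no move and is arbitrary. *)
Lemma run_of_moves (x0 : X) (P : set X) (Q : nat -> set X) (u : nat -> seq X) :
  exists r : run X, [/\ initI r = P, setII r = Q & forall n, moveI r n = u n].
Proof.
pose len n := size (flatten (mkseq u n)).
pose enough i := xget 0%N [set n | (i < len n)%N].
pose r := @Run X P Q len
  (fun i => nth x0 (flatten (mkseq u (enough i.-1))) i.-1) erefl.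
exists r; split => //; apply: (@moveI_flatten r x0) => // n i /= lti.
have nth_prefix a b : (i < len a)%N -> (a <= b)%N ->
    nth x0 (flatten (mkseq u b)) i = nth x0 (flatten (mkseq u a)) i.
  move=> lta /subnKC <-; elim: (b - a)%N => [|c IH]; first by rewrite addn0.
  rewrite addnS mkseqS flatten_rcons nth_cat -/(len _) IH ifT //.
  apply: (leq_trans lta); elim: (c) => [|d]; first by rewrite addn0.
  move=> /leq_trans; apply.
  by rewrite addnS /len mkseqS flatten_rcons size_cat leq_addr.
have lte : (i < len (enough i))%N.
  exact: (@xgetPex _ 0%N [set m | (i < len m)%N] (ex_intro _ n lti)).
have [le|/ltnW le] := leqP n (enough i); first exact: nth_prefix.
by rewrite (nth_prefix _ _ lte le).
Qed.

Lemma run_of_strategies (x0 : X) (s : strategyI X) (t : strategyII X) :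
  exists r : run X, followsI s r /\ followsII t r.
Proof.
pose ans (h : seq (set X) * seq (seq X)) := t (strI_init s) h.2.
(* hist n lists the first n moves of II and of I, not counting the initial P *)
pose next h := (rcons h.1 (ans h), rcons h.2 (strI_step s (rcons h.1 (ans h)))).
pose hist n := iter n next ([::], [::]).
pose Q n := ans (hist n).
pose u n := strI_step s (rcons (hist n).1 (Q n)).
have histE n : hist n = (mkseq Q n, mkseq u n).
  elim: n => // n IH.
  by rewrite !mkseqS /= -/(hist n) {1}/next -/(Q n) -/(u n) IH.
have [r [rP rQ rU]] := run_of_moves x0 (strI_init s) Q u.
exists r; split=> [|n]; last first.
  by rewrite rP rQ /Q /ans histE (eq_mkseq rU).
by split=> // n; rewrite rU rQ /u histE -mkseqS.
Qed.

End Runs.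

Section Games.
Context (R : realType) (X : metricType R).
Variables (Sigma : set (set X)) (f : X -> R).

(** * Comparing winning strategies *)

(** When the two strategies are played against each other, the legality of each
    move follows from that of the earlier ones, so the run is legal and both
    players would win it. *)
Lemma not_both_win (L : set nat) (x0 : X) :
  I_wins L Sigma f -> ~ II_wins L Sigma f.
Proof.
move=> [s ws] [t wt]; have [r [fs ft]] := run_of_strategies x0 s t.
have [init0 stepI winI] := ws r fs.
have [legII winII] := wt r ft init0.
have both n : forall m, (m < n)%N -> legal_stepI L r m.
  elim: n => // n IH m; rewrite ltnS leq_eqVlt => /predU1P[->|/IH//].
  apply: stepI => k lekn; apply: legII => j ltjk.
  by apply: IH; apply: leq_trans ltjk lekn.
apply: winI => [n|]; first exact/legII/both.
by apply: winII => n; apply: (both n.+1).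
Qed.

Lemma legal_stepI_mono (L L' : set nat) (r : run X) (n : nat) :
  L `<=` L' -> legal_stepI L r n -> legal_stepI L' r n.
Proof. by move=> LL' [/LL' ? ?]; split. Qed.

Lemma I_wins_mono (L L' : set nat) :
  L `<=` L' -> I_wins L Sigma f -> I_wins L' Sigma f.
Proof.
move=> LL' [s ws]; exists s => r /ws[init0 stepI winI]; split=> // n legII.
exact/(legal_stepI_mono LL')/stepI.
Qed.

Lemma II_wins_anti (L L' : set nat) :
  L `<=` L' -> II_wins L' Sigma f -> II_wins L Sigma f.
Proof.
move=> LL' [t wt]; exists t => r ft init0; have [legII winII] := wt r ft init0.
split=> [n stepI|stepI].
  by apply: legII => m ltmn; apply/(legal_stepI_mono LL')/stepI.
by apply: winII => n; apply/(legal_stepI_mono LL').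
Qed.

Lemma G_one_sub_fin : G_one `<=` G_fin.
Proof. by move=> _ ->. Qed.

(** * The deciding condition *)

(** Replacing points by their graph points makes one ball control both x and
    f x, and turns the two convergences of the payoff into a single one. *)
Definition graph_point (x : X) : X * R := (x, f x).

Definition has_small (P : set X) (l : X) (e : R) : Prop :=
  exists Q, [/\ Sigma Q, Q `<=` P &
                forall y, Q y -> ball (graph_point l) e (graph_point y)].

(** Quantifying over the radii 1/(n+1) alone makes the choice of a set for each
    radius a sequence, and gives each point a largest bad radius in [escape]. *)
Definition shrinkable : Prop :=
  forall P, Sigma P -> exists l, forall n, has_small P l (harmonic n).

Lemma harmonic_anti (m n : nat) :
  (m <= n)%N -> (harmonic n <= harmonic m :> R)%R.
Proof. by move=> lemn; rewrite /harmonic /= lef_pV2 ?posrE // ler_nat. Qed.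

Lemma payoffII_graph (r : run X) :
  payoffII f r <->
  exists l, graph_point (pt r i) @[i --> \oo] --> graph_point l.
Proof.
split=> -[l].
  by case=> cx cf; exists l; exact: (cvg_pair cx cf).
move=> cg; exists l; split.
  apply: (@cvg_comp _ _ _ (fun i => graph_point (pt r i)) fst _ _ _ cg).
  exact: cvg_fst.
apply: (@cvg_comp _ _ _ (fun i => graph_point (pt r i)) snd _ _ _ cg).
  exact: cvg_snd.
Qed.

(** A point with a large index is played at a late step, hence taken from a
    small set; this is where moves of several points are dealt with. *)
Lemma step_of_point (r : run X) :
  (forall n, (Defs.cut r n < Defs.cut r n.+1)%N) ->
  forall N i, (Defs.cut r N < i)%N ->
  exists2 n, (N <= n)%N & (Defs.cut r n < i <= Defs.cut r n.+1)%N.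
Proof.
move=> cutS N i ltNi.
have le_cut n : (n <= Defs.cut r n)%N.
  by elim: n => // n /leq_ltn_trans; apply.
have : (i <= Defs.cut r (N + i))%N.
  by apply: leq_trans (le_cut _); apply: leq_addl.
elim: {2}i => [|k IH]; first by rewrite addn0 leqNgt ltNi.
rewrite addnS => lei.
have [/IH//|lt] := leqP i (Defs.cut r (N + k)).
by exists (N + k)%N; rewrite ?leq_addr // lt.
Qed.

Lemma shrinkable_II_wins (L : set nat) :
  L `<=` G_fin -> shrinkable -> II_wins L Sigma f.
Proof.
move=> Lpos small.
have /choice[q qP] : forall P, exists Q : nat -> set X, Sigma P ->
    exists l, forall n, [/\ Sigma (Q n), Q n `<=` P &
      forall y, Q n y -> ball (graph_point l) (harmonic n) (graph_point y)].
  move=> P.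
  have [/small[l /choice[q qP]]|nP] := pselect (Sigma P).
    by exists q => _; exists l.
  by exists (fun _ => set0) => /nP.
exists (fun P us => q P (size us)) => r fr /qP[l lP].
have setE n : setII r n = q (initI r) n by rewrite fr size_mkseq.
split=> [n _|legI].
  by rewrite /legal_II setE; have [? ? _] := lP n.
have cutS n : (Defs.cut r n < Defs.cut r n.+1)%N.
  by have [/Lpos] := legI n; rewrite /G_fin /= subn_gt0.
apply/payoffII_graph; exists l; apply/cvg_ballP => _/posnumP[e].
have [N _ /(_ N (leqnn N)) /= radN] := near_infty_natSinv_lt e.
exists (Defs.cut r N).+1 => // i /= ltNi.
have [n leNn ni] := step_of_point cutS ltNi.
have [_ /(_ i ni)] := legI n; rewrite setE.
have [_ _ Qball] := lP n; move=> /Qball; apply: le_ball.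
exact: le_trans (harmonic_anti leNn) (ltW radN).
Qed.

(** Among the balls around x of radius 1/(k+1) that include no member of Sigma
    inside P, there is a largest one, if there are any. The set Q is not
    included in it, and a point of Q outside it is outside all the smaller ones
    as well. *)
Lemma escape (P Q : set X) (x : X) :
  Sigma Q -> Q `<=` P -> Q !=set0 ->
  exists2 y, Q y &
    forall k, ~ has_small P x (harmonic k) ->
              ~ ball (graph_point x) (harmonic k) (graph_point y).
Proof.
move=> SQ QP [y0 Qy0].
have [[k0 nk0]|all_small] := pselect (exists k, ~ has_small P x (harmonic k));
  last by exists y0 => // k nk; case: all_small; exists k.
have ex : exists k, `[< ~ has_small P x (harmonic k) >].
  by exists k0; apply/asboolP.
case: (ex_minnP ex) => m /asboolP nm minm.
have [y Qy ny] : exists2 y, Q y &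
    ~ ball (graph_point x) (harmonic m) (graph_point y).
  apply: contrapT => none; apply: nm; exists Q; split=> // y Qy.
  by apply: contrapT => ny; apply: none; exists y.
exists y => // k nk; have lemk : (m <= k)%N by apply/minm/asboolP.
by move=> /(le_ball (harmonic_anti lemk)).
Qed.

(** Along a sequence converging to l, the distances covered by [escape] stay
    bounded below: if no member of Sigma inside P fits in the ball of radius
    1/(k+1) around l, then none fits in a ball of half that radius around a
    point that is close enough to l. *)
Lemma no_escape (P : set X) (x : nat -> X) (l : X) (k : nat) :
  ~ has_small P l (harmonic k) ->
  (forall i m, ~ has_small P (x i) (harmonic m) ->
     ~ ball (graph_point (x i)) (harmonic m) (graph_point (x i.+1))) ->
  ~ graph_point (x i) @[i --> \oo] --> graph_point l.
Proof.
move=> nsmall esc cvgx.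
pose m := (k.*2.+1)%N.
have hm : (harmonic m = harmonic k / 2 :> R)%R.
  by rewrite /harmonic /= /m -doubleS -muln2 natrM invfM.
have e0 : (0 < harmonic m / 2 :> R)%R by rewrite divr_gt0 // harmonic_gt0.
have [N _ close] := (cvg_ballP _ _).1 cvgx _ e0.
apply: (esc N m) => [[Q [SQ QP Qball]]|].
  apply: nsmall; exists Q; split=> // y /Qball.
  rewrite [harmonic k]splitr -hm; apply: ball_triangle.
  by apply: le_ball (close N (leqnn N)); lra.
rewrite [harmonic m]splitr; apply: (@ball_triangle _ _ (graph_point l)).
  exact/ball_sym/close/leqnn.
exact/close/leqnSn.
Qed.

Lemma not_shrinkable_I_wins (x0 : X) :
  (forall A, Sigma A -> A !=set0) -> ~ shrinkable -> I_wins G_one Sigma f.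
Proof.
move=> Sneq0 nsmall.
have [P [SP nP]] : exists P, Sigma P /\
    forall l, exists n, ~ has_small P l (harmonic n).
  apply: contrapT => none; apply: nsmall => P SP.
  apply: contrapT => nl; apply: none; exists P; split=> // l.
  apply: contrapT => nn; apply: nl; exists l => n.
  by apply: contrapT => ns; apply: nn; exists n.
have /choice[c cP] : forall xQ : X * set X, exists y,
    Sigma xQ.2 -> xQ.2 `<=` P -> xQ.2 y /\
      forall k, ~ has_small P xQ.1 (harmonic k) ->
                ~ ball (graph_point xQ.1) (harmonic k) (graph_point y).
  move=> -[x Q] /=.
  have [[SQ QP]|nQ] := pselect (Sigma Q /\ Q `<=` P).
    by have [y] := escape x SQ QP (Sneq0 _ SQ); exists y.
  by exists x0 => SQ QP; case: nQ.
(* the next point depends only on the current point and the last answer of II;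
   x0 stands for the current point before the first step *)
pose pos := foldl (fun x Q => c (x, Q)) x0.
exists (StrategyI P (fun As => [:: pos As])) => r [/= rP rU].
have cutE n : Defs.cut r n = n.
  elim: n => [|n IH]; first exact: cut0.
  have := congr1 size (rU n); rewrite size_map size_iota IH subSS /=.
  by lia.
have ptE n : pt r n.+1 = pos (mkseq (setII r) n.+1).
  by have := rU n; rewrite /moveI !cutE /index_iota subSS subSnn => -[].
have legal_pt n : legal_II Sigma r n -> setII r n (pt r n.+1) /\
    forall k, ~ has_small P (pos (mkseq (setII r) n)) (harmonic k) ->
      ~ ball (graph_point (pos (mkseq (setII r) n))) (harmonic k)
              (graph_point (pt r n.+1)).
  rewrite /legal_II rP ptE mkseqS /pos foldl_rcons => -[SQ QP].
  exact: (cP (_, setII r n) SQ QP).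
split=> [|n legII|legII]; first by rewrite /legal_initI rP.
  split=> [|i]; first by rewrite /G_one /= !cutE subSnn.
  rewrite !cutE -eqn_leq => /eqP <-.
  exact: (legal_pt n (legII n (leqnn n))).1.
move=> /payoffII_graph[l cvgl]; have [k nk] := nP l.
apply: (no_escape (x := fun i => pt r i.+1) nk) => [i m|].
  by rewrite {1 2}ptE; apply: (legal_pt i.+1 (legII i.+1)).2.
apply: (@cvg_comp _ _ _ S (fun i => graph_point (pt r i)) _ _ _ _ cvgl).
exact: (cvg_addnl 1).
Qed.

End Games.

Theorem corollary2p5 (R : realType) (X : metricType R)
    (Sigma : set (set X)) (f : X -> R)
    (Sigma_neq0 : Sigma !=set0)
    (Sigma_mem_neq0 : forall A : set X, Sigma A -> A !=set0) :
  (I_wins G_one Sigma f <-> I_wins G_fin Sigma f) /\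
  (II_wins G_one Sigma f <-> II_wins G_fin Sigma f).
Proof.
have [A /Sigma_mem_neq0[x0 _]] := Sigma_neq0.
have I_mono := @I_wins_mono _ _ Sigma f _ _ G_one_sub_fin.
have II_anti := @II_wins_anti _ _ Sigma f _ _ G_one_sub_fin.
have [small|nsmall] := pselect (shrinkable Sigma f).
  have winII : II_wins G_fin Sigma f by apply: shrinkable_II_wins.
  have nI := not_both_win x0 ^~ winII.
  by split; [split=> [/I_mono/nI|/nI] | split=> [_|/II_anti]].
have winI := not_shrinkable_I_wins x0 Sigma_mem_neq0 nsmall.
have nII := not_both_win x0 winI.
by split; [split=> [/I_mono|_] | split=> [/nII|/II_anti/nII]].
Qed.
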